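(* Let $S$ be a semigroup and let $T$ be a subsemigroup of finite Green index. Then $S$ is finitely generated if and only if $T$ is finitely generated, in which case $S$ and $T$ have the same type of growth.
   Context: For a semigroup $S$, $S^1=S\cup\{1\}$ denotes $S$ with a new identity element $1\notin S$ adjoined; for $X\subseteq S$, $X^1=X\cup\{1\}$. For a subsemigroup $T$ of $S$ and $u,v\in S$: $u\,\mathscr{R}^T v$ iff $uT^1=vT^1$; $u\,\mathscr{L}^T v$ iff $T^1u=T^1v$; $\mathscr{H}^T=\mathscr{R}^T\cap\mathscr{L}^T$. Each $\mathscr{H}^T$-class lies wholly in $T$ or wholly in $S\setminus T$. The Green index of $T$ in $S$ is one more than the number of $\mathscr{H}^T$-classes contained in $S\setminus T$. A growth function is a monotone non-decreasing function $\mathbb{N}\to\mathbb{N}$. Write $\alpha_1\preccurlyeq\alpha_2$ if there are natural numbers $k_1,k_2\ge 1$ with $\alpha_1(t)\le k_1\alpha_2(k_2t)$ for all $t\in\mathbb{N}$, and $\alpha_1\sim\alpha_2$ if $\alpha_1\preccurlyeq\alpha_2$ and $\alpha_2\preccurlyeq\alpha_1$. The growth type of $\alpha$ is its $\sim$-class. For a semigroup $S$, $X\subseteq S$, $s\in S^1$ and $n\in\mathbb{N}$, let $\overrightarrow{\mathcal{B}}_X(s,n)=\{sx_1\cdots x_r\in S : x_i\in X^1,\ r\le n\}$. For $S$ generated by a finite set $A$, its growth function is $g_S(m)=|\overrightarrow{\mathcal{B}}_A(1,m)|$; its growth type is independent of the choice of finite generating set $A$ and is called the type of growth of $S$. *)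

(* Defs.v *)
From HB Require Import structures.
From mathcomp Require Import all_boot finmap.
From mathcomp Require Import all_classical.

Set Implicit Arguments.
Unset Strict Implicit.
Unset Printing Implicit Defensive.

Local Open Scope group_scope.
Local Open Scope classical_set_scope.

(* The monoid S^1.  The identity None is always new, even if S already has an
   identity element. *)
Definition adjoin1 (S : semigroupType) : Type := option S.

Section Adjoin1.
Variable S : semigroupType.

HB.instance Definition _ := Choice.copy (adjoin1 S) (option S).

Definition adjoin1_mul (u v : adjoin1 S) : adjoin1 S :=
  match u, v with
  | None, _ => v
  | _, None => u
  | Some x, Some y => Some (x * y)
  end.

Fact adjoin1_mulA : associative adjoin1_mul.
Proof. by move=> [x|] [y|] [z|] //=; rewrite mulgA. Qed.

HB.instance Definition _ := isSemigroup.Build (adjoin1 S) adjoin1_mulA.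

Fact adjoin1_mul1 : left_id None adjoin1_mul.
Proof. by case. Qed.

Fact adjoin1_1mul : right_id None adjoin1_mul.
Proof. by case. Qed.

HB.instance Definition _ :=
  Semigroup_isMonoid.Build (adjoin1 S) adjoin1_mul1 adjoin1_1mul.

Definition inS1 (x : S) : adjoin1 S := Some x.

Definition setadj1 (X : set S) : set (adjoin1 S) := 1 |` (inS1 @` X).

End Adjoin1.

Section Subsemigroups.
Variable S : semigroupType.
Implicit Types (T X A : set S) (u v : S).

Definition set_mulg_closed T := forall u v, T u -> T v -> T (u * v).

Definition subsemigroup T := T !=set0 /\ set_mulg_closed T.

(* The empty set has to be allowed among the sets that smallest intersects,
   otherwise it would generate the intersection of all subsemigroups. *)
Definition finite_generating_set A T :=
  finite_set A /\ smallest set_mulg_closed A = T.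

Definition finitely_generated T := exists A, finite_generating_set A T.

Definition greenR T u v :=
  [set inS1 u * t | t in setadj1 T] = [set inS1 v * t | t in setadj1 T].

Definition greenL T u v :=
  [set t * inS1 u | t in setadj1 T] = [set t * inS1 v | t in setadj1 T].

Definition greenH T u v := greenR T u v /\ greenL T u v.

Definition greenH_class T u : set S := [set v | greenH T u v].

Definition outer_greenH_classes T : set (set S) :=
  [set C | C `<=` ~` T /\ exists u, C = greenH_class T u].

Definition finite_green_index T := finite_set (outer_greenH_classes T).

Definition ball_right X (s : adjoin1 S) (n : nat) : set S :=
  [set y | exists r (x : 'I_r -> adjoin1 S),
     [/\ r <= n, forall i, setadj1 X (x i) & inS1 y = s * \prod_(i < r) x i]].

(* Balls over a finite A are finite; for an infinite ball fset_set is empty. *)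
Definition growth A (m : nat) : nat := #|` fset_set (ball_right A 1 m)|.

End Subsemigroups.

Definition growth_function (a : nat -> nat) := {homo a : m n / m <= n}.

Definition growth_le (a1 a2 : nat -> nat) :=
  exists k1 k2, [/\ 1 <= k1, 1 <= k2 & forall t, a1 t <= k1 * a2 (k2 * t)]%N.

Definition growth_equiv (a1 a2 : nat -> nat) :=
  growth_le a1 a2 /\ growth_le a2 a1.

Definition growth_type (a : nat -> nat) : set (nat -> nat) :=
  [set b | growth_function b /\ growth_equiv a b].

(* Finite generating sets of T and U are quantified universally because the
   growth type does not depend on them.  A generating set of T yields the same
   balls in T as in S. *)
Definition same_type_of_growth (S : semigroupType) (T U : set S) :=
  forall A B, finite_generating_set A T -> finite_generating_set B U ->
    growth_type (growth A) = growth_type (growth B).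

(* Main.v *)
Require Import Defs.
From mathcomp Require Import all_boot finmap all_classical.

(** The proof is a two-sided Schreier rewriting.  Choose a finite set [K] of
    representatives of the H^T-classes outside [T].  Every element of [S^1]
    lies in [T^1 K^1], by the L^T half of the Green relation, so [S] is
    generated by [K] together with any generating set of [T].

    Conversely let [A] be a finite generating set of [S].  Each of the finitely
    many products [h a], with [h] in [K^1] and [a] in [A^1], equals [x k] with
    [x] in [T^1] and [k] in [K^1]; let [X] collect these [x].  Starting from [1]
    and sweeping a representative rightwards over a word,
      [a_1 ... a_n = x_1 ... x_n h]      ([push_representative_right]).
    When the word represents an element of [T] it remains to absorb [h].  The
    representative is swept back leftwards, now by the R^T half: a product
    [x h] outside [T] equals [k z] with [k] in [K] and [z] in a finite
    subset of [T^1].  As R^T is a left congruence and [T] is a union of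
    R^T-classes, whether a suffix [x_i ... x_n h] lies in [T] depends
    only on [x_i] and the current representative.  A suffix in [T] must
    occur, since the whole word is in [T], and there the representative is
    absorbed into one of finitely many elements of [T]
    ([push_representative_left]).  So [T] is finitely generated.

    For growth, [T] sits in [S] as a subset with finite generating set, which
    gives one inequality.  The first sweep embeds the ball of radius [n] of [S]
    in the product of the words of length [n] over [X^1] with the finite set
    [K^1], which costs only a constant factor and gives the other one. *)

Local Open Scope group_scope.
Local Open Scope classical_set_scope.

(** * Finite choice *)

(** The set [K] of chosen values is kept tight, each member being a value at some
    [p], so that any property included in [Q] passes to all of [K]. *)
Lemma finite_choice {I J : Type} {P : set I} (Q : I -> J -> Prop) :
    finite_set P -> (forall p, P p -> exists s, Q p s) ->
  exists K : set J, [/\ finite_set K,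
    forall p, P p -> exists2 s, K s & Q p s &
    forall s, K s -> exists2 p, P p & Q p s].
Proof.
move=> finP PQ.
(* [option J] provides the default value outside [P], as [J] may be empty. *)
have /choice[f fP] : forall p, exists o : option J,
    P p -> exists2 s, o = Some s & Q p s.
  move=> p; have [/PQ[s Qps]|nPp] := pselect (P p); last by exists None.
  by exists (Some s) => _; exists s.
exists (Some @^-1` (f @` P)); split.
- apply: finite_preimage; last exact: finite_image.
  by move=> x y _ _ [].
- move=> p Pp; have [s fs Qps] := fP p Pp.
  by exists s => //; exists p.
- move=> s [p Pp fp]; have [s' fs' Qps'] := fP p Pp.
  by exists p => //; move: fs'; rewrite fp => -[->].
Qed.

Lemma finite_set_nat_bounded (N : set nat) :
  finite_set N -> exists c, forall n, N n -> (n <= c)%N.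
Proof.
move=> finN; exists (\max_(n <- fset_set N) n)%N => n Nn.
apply: (@leq_bigmax_seq _ _ xpredT (fun n => n)) => //.
by rewrite in_fset_set // inE.
Qed.

Lemma fset_set_subset_card {T : choiceType} {X Y : set T} :
  X `<=` Y -> finite_set Y -> (#|` fset_set X| <= #|` fset_set Y|)%N.
Proof.
move=> XY finY; apply: fsubset_leq_card.
by rewrite -fset_set_sub //; apply: sub_finite_set finY.
Qed.

Lemma fset_set_image2_card {T U V : choiceType} (f : T -> U -> V)
    {X : set T} {Y : set U} :
    finite_set X -> finite_set Y ->
  (#|` fset_set [set f x y | x in X & y in Y]|
     <= #|` fset_set X| * #|` fset_set Y|)%N.
Proof.
move=> finX finY; rewrite -(size_allpairs f).
apply: uniq_leq_size (fset_uniq _) _ => v.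
rewrite in_fset_set ?inE; last exact: finite_image2.
case=> x Xx [y Yy <-]; apply/allpairsP; exists (x, y).
by rewrite !in_fset_set //; split; rewrite ?inE.
Qed.

(** * Powers of a subset of a monoid *)

(** When [1] is in [Y], as for [Y = setadj1 X], this is the set of products of at
    most [n] factors from [Y]; balls are studied in this form. *)
Definition set_pow {M : monoidType} (Y : set M) (n : nat) : set M :=
  iter n (fun W => [set y * w | y in Y & w in W]) [set 1].

Section SetPow.
Context {M : monoidType}.
Implicit Types Y Z W : set M.

Lemma finite_set_pow Y n : finite_set Y -> finite_set (set_pow Y n).
Proof.
move=> finY; elim: n => [|n IHn]; first exact: finite_set1.
exact: finite_image2.
Qed.

Lemma set_pow_subset Y Z n : Y `<=` Z -> set_pow Y n `<=` set_pow Z n.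
Proof.
move=> YZ; elim: n => [//|n IHn] _ [y Yy [w Yw <-]].
by exists y; [exact: YZ|exists w => //; exact: IHn].
Qed.

Lemma set_pow1 Y y : Y y -> set_pow Y 1 y.
Proof. by exists y => //; exists 1 => //; rewrite mulg1. Qed.

Lemma set_powM Y m n u v :
  set_pow Y m u -> set_pow Y n v -> set_pow Y (m + n) (u * v).
Proof.
move=> + Yv; elim: m u => [u /= ->|m IHm _ [y Yy [w Yw <-]]].
  by rewrite mul1g.
by rewrite -mulgA; exists y => //; exists (w * v) => //; exact: IHm.
Qed.

Lemma set_pow_leq Y m n : Y 1 -> (m <= n)%N -> set_pow Y m `<=` set_pow Y n.
Proof.
move=> Y1 /subnK<-; elim: (n - m)%N => [//|k IHk] w /IHk Yw.
by exists 1 => //; exists w => //; rewrite mul1g.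
Qed.

Lemma set_pow_pow Y Z c n :
  Y `<=` set_pow Z c -> set_pow Y n `<=` set_pow Z (c * n).
Proof.
move=> YZ; elim: n => [|n IHn]; first by rewrite muln0.
move=> _ [y Yy [w Yw <-]]; rewrite mulnS.
by apply: set_powM; [exact: YZ|exact: IHn].
Qed.

Lemma set_pow_closed Y Z n : Y `<=` Z -> Z 1 ->
  (forall u v, Z u -> Z v -> Z (u * v)) -> set_pow Y n `<=` Z.
Proof.
move=> YZ Z1 ZM; elim: n => [_ ->//|n IHn] _ [y Yy [w Yw <-]].
by apply: ZM; [exact: YZ|exact: IHn].
Qed.

End SetPow.

(** * Balls and generated subsemigroups *)

Section Balls.
Context {S : semigroupType}.
Implicit Types (X A B T : set S) (u v : S).

Lemma finite_setadj1 X : finite_set X -> finite_set (setadj1 X).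
Proof.
by move=> finX; rewrite finite_setU; split=> //; exact: finite_image.
Qed.

Lemma setadj1_subset X Y : X `<=` Y -> setadj1 X `<=` setadj1 Y.
Proof.
by move=> XY _ [->|[x Xx <-]]; [left|right; exists x => //; exact: XY].
Qed.

Lemma setadj1_inS1 X x : setadj1 X (inS1 x) <-> X x.
Proof. by split=> [[//|[y Xy [<-]]//]|Xx]; right; exists x. Qed.

Lemma setadj1M X (u v : adjoin1 S) : set_mulg_closed X ->
  setadj1 X u -> setadj1 X v -> setadj1 X (u * v).
Proof.
move=> XM [->|[x Xx <-]]; first by rewrite mul1g.
move=> [->|[y Xy <-]]; first by rewrite mulg1; right; exists x.
by right; exists (x * y) => //; exact: XM.
Qed.

(** A product of [r <= n] factors is padded with [1]s to exactly [n] factors. *)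
Lemma ball_rightE X n y :
  ball_right X 1 n y <-> set_pow (setadj1 X) n (inS1 y).
Proof.
split=> [[r [x [le_rn Xx ->]]]|Xy].
  rewrite mul1g; apply: (set_pow_leq _ _ _ _ le_rn); first by left.
  elim: r x Xx {le_rn} => [x _|r IHr x Xx]; first by rewrite big_ord0.
  rewrite big_ord_recl; exists (x ord0); first exact: Xx.
  by eexists; last reflexivity; apply: IHr => i; exact: Xx.
have [x [Xx yE]] : exists x : 'I_n -> adjoin1 S,
    (forall i, setadj1 X (x i)) /\ inS1 y = \prod_(i < n) x i.
  elim: n {y} (inS1 y) Xy => [w -> | n IHn _ [a Xa [w /IHn[x [Xx ->]] <-]]].
    by exists (fun=> 1); split; [left|rewrite big_ord0].
  (* [a] followed by [x] *)
  exists (fun i => if unlift ord0 i is Some j then x j else a); split.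
    by move=> i; case: unliftP.
  rewrite big_ord_recl unlift_none; congr (_ * _).
  by apply: eq_bigr => i _; rewrite liftK.
by exists n, x; split=> //; rewrite mul1g.
Qed.

Lemma ball_right_setE X n :
  ball_right X 1 n = @inS1 S @^-1` set_pow (setadj1 X) n.
Proof. by apply/seteqP; split=> y /ball_rightE. Qed.

Lemma finite_ball X n : finite_set X -> finite_set (ball_right X 1 n).
Proof.
move=> finX; rewrite ball_right_setE; apply: finite_preimage.
  by move=> x y _ _ [].
exact/finite_set_pow/finite_setadj1.
Qed.

Lemma smallest_mulg_closedE A y :
  smallest (@set_mulg_closed S) A y <->
  exists n, set_pow (setadj1 A) n (inS1 y).
Proof.
split.
  apply: (smallest_sub
    (X := [set y | exists n, set_pow (setadj1 A) n (inS1 y)])).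
    move=> u v [m Am] [n An]; exists (m + n)%N.
    exact: (set_powM _ _ _ _ _ Am An).
  by move=> x Ax; exists 1%N; apply/set_pow1/setadj1_inS1.
case=> n An X [XM AX]; apply/setadj1_inS1; move: An; apply: set_pow_closed.
- exact: setadj1_subset.
- by left.
- by move=> u v; exact: setadj1M.
Qed.

(** Each element of [X] lies in some ball over [A]; the balls increase and [X] is
    finite, so a single radius serves all of [X]. *)
Lemma finite_subset_ball A X :
    finite_set X -> X `<=` smallest (@set_mulg_closed S) A ->
  exists2 c, (0 < c)%N & setadj1 X `<=` set_pow (setadj1 A) c.
Proof.
move=> finX XA; have A1 : setadj1 A 1 by left.
have [x Xx|N [finN Nx _]] :=
    @finite_choice _ _ _ (fun x n => set_pow (setadj1 A) n (inS1 x)) finX.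
  by apply/smallest_mulg_closedE; apply: XA.
have [c cP] := finite_set_nat_bounded _ finN.
exists c.+1 => // _ [->|[x Xx <-]].
  exact: (set_pow_leq _ _ _ A1 (leq0n _)).
have [n Nn An] := Nx x Xx.
exact: (set_pow_leq _ _ _ A1 (leqW (cP n Nn))).
Qed.

End Balls.

(** * Factorisation through finitely many outer representatives *)

Section Green.
Context {S : semigroupType}.
Implicit Types (X Y A K T : set S) (u : S).

Lemma greenR_mull T (s u v : S) : greenR T u v -> greenR T (s * u) (s * v).
Proof.
move=> uv.
have sE w : [set inS1 (s * w) * t | t in setadj1 T] =
    [set inS1 s * x | x in [set inS1 w * t | t in setadj1 T]].
  by rewrite image_comp; apply: eq_imagel => t _; rewrite /= [RHS]mulgA.
by rewrite /greenR !sE uv.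
Qed.

Lemma greenR_factor T (u v : S) : greenR T u v ->
  exists2 t, setadj1 T t & inS1 u = inS1 v * t.
Proof.
move=> uv; have : [set inS1 u * t | t in setadj1 T] (inS1 u).
  by exists 1; [left|rewrite mulg1].
by rewrite uv => -[t Tt <-]; exists t.
Qed.

Lemma greenL_factor T (u v : S) : greenL T u v ->
  exists2 t, setadj1 T t & inS1 u = t * inS1 v.
Proof.
move=> uv; have : [set t * inS1 u | t in setadj1 T] (inS1 u).
  by exists 1; [left|rewrite mul1g].
by rewrite uv => -[t Tt <-]; exists t.
Qed.

(** A class of R^T that meets [T] lies in [T], because [v T^1] is contained in
    [T] for [v] in [T]. *)
Lemma greenR_closed T (u v : S) :
  set_mulg_closed T -> greenR T u v -> T v -> T u.
Proof.
move=> TM /greenR_factor[t Tt uE] Tv; apply/setadj1_inS1; rewrite uE.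
exact/setadj1M/Tt/setadj1_inS1.
Qed.

Lemma outer_transversal T : set_mulg_closed T -> finite_green_index T ->
  exists K, [/\ finite_set K, K `<=` ~` T &
    forall u, ~ T u -> exists2 h, K h & greenH T u h].
Proof.
move=> TM finT.
have [C [_ [u ->]]|K [finK Kout outK]] :=
    @finite_choice _ _ _ (fun (C : set S) h => C h) finT.
  by exists u.
exists K; split=> // [h /outK[C [CT _]]|u nTu]; first exact: CT.
suff /Kout[h Kh uh] : outer_greenH_classes T (greenH_class T u) by exists h.
split; last by exists u.
by move=> v [uv _] Tv; apply: nTu; apply: greenR_closed uv Tv.
Qed.

Variables (T K : set S).
Hypothesis TM : set_mulg_closed T.
Hypothesis finK : finite_set K.
Hypothesis KT : K `<=` ~` T.
Hypothesis KP : forall u, ~ T u -> exists2 h, K h & greenH T u h.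

Lemma outer_left_factor (w : adjoin1 S) :
  exists t h, [/\ setadj1 T t, setadj1 K h & w = t * h].
Proof.
case: w => [u|]; last by exists 1, 1; split; [left|left|rewrite mulg1].
have [Tu|/KP[h Kh [_ /greenL_factor[t Tt uE]]]] := pselect (T u).
  by exists (inS1 u), 1; split; [exact/setadj1_inS1|left|rewrite mulg1].
by exists t, (inS1 h); split=> //; exact/setadj1_inS1.
Qed.

(** The values that are [1] are dropped from [X]; [setadj1 X] restores them. *)
Lemma finite_setadj1_choice {I : Type} {P : set I}
    (Q : I -> adjoin1 S -> Prop) :
    finite_set P -> (forall p, P p -> exists2 t, setadj1 T t & Q p t) ->
  exists X, [/\ finite_set X, X `<=` T &
    forall p, P p -> exists2 t, setadj1 X t & Q p t].
Proof.
move=> finP PQ.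
have [p /PQ[t Tt Qpt]|X [finX PX XP]] :=
    @finite_choice _ _ _ (fun p t => setadj1 T t /\ Q p t) finP.
  by exists t.
exists (@inS1 S @^-1` X); split.
- by apply: finite_preimage finX => x y _ _ [].
- by move=> x /XP[p _ [/setadj1_inS1]].
- move=> p /PX[[x|] Xt [Tt Qpt]]; last by exists 1 => //; left.
  by exists (inS1 x) => //; exact/setadj1_inS1.
Qed.

(** In [h a_1 ... a_n] the product [h a_1] is replaced by [x_1 k] with [x_1] in
    [T^1], and [k] takes over the role of [h] for the remaining letters. *)
Lemma push_representative_right A : finite_set A ->
  exists X, [/\ finite_set X, X `<=` T & forall n,
    set_pow (setadj1 A) n `<=`
    [set w * h | w in set_pow (setadj1 X) n & h in setadj1 K]].
Proof.
move=> finA.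
pose Q (p : adjoin1 S) t := exists2 h, setadj1 K h & p = t * h.
have finKA : finite_set [set h * a | h in setadj1 K & a in setadj1 A].
  by apply: finite_image2; exact: finite_setadj1.
have [p _|X [finX XT XP]] := finite_setadj1_choice Q finKA.
  by have [t [h [Tt Kh ->]]] := outer_left_factor p; exists t => //; exists h.
exists X; split=> // n w Aw.
(* The induction needs an arbitrary leading representative. *)
suff: forall h, setadj1 K h ->
    [set x * k | x in set_pow (setadj1 X) n & k in setadj1 K] (h * w).
  by move/(_ 1); rewrite mul1g; apply; left.
elim: n w Aw => [_ ->|n IHn _ [a Aa [w Aw <-]]] h Kh.
  by exists 1 => //; exists h => //; rewrite mulg1 mul1g.
have [|x Xx [k Kk hak]] := XP (h * a).
  by exists h => //; exists a.
have [x' Xx' [k' Kk' kw]] := IHn w Aw k Kk.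
exists (x * x'); first by exists x => //; exists x'.
by exists k' => //; rewrite -mulgA kw !mulgA -hak.
Qed.

(** In [x_1 ... x_n h] the product [x_n h] is replaced by [k z] with [z] in [T^1]
    as long as it is outside [T]; the relation R^T between each suffix and
    its current representative tells when it enters [T].  Then [x_i k]
    is a single letter of [Y], followed by the [z] already produced and preceded
    by [x_1 ... x_(i-1)], whose letters are in [X]. *)
Lemma push_representative_left X : finite_set X -> X `<=` T ->
  exists Y, [/\ finite_set Y, Y `<=` T, X `<=` Y & forall n w h y,
    set_pow (setadj1 X) n w -> K h -> inS1 y = w * inS1 h -> T y ->
    set_pow (setadj1 Y) n (inS1 y)].
Proof.
move=> finX XT.
pose P := [set x * inS1 h | x in setadj1 X & h in K].
pose Q (p : adjoin1 S) t := forall u, p = inS1 u ->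
  if `[< T u >] then t = inS1 u
  else exists h, [/\ K h, inS1 u = inS1 h * t & greenR T u h].
have finP : finite_set P by apply: finite_image2 => //; exact: finite_setadj1.
have [p Pp|Z [finZ ZT ZP]] := finite_setadj1_choice Q finP.
  case: p Pp => [u|] Pp; last by exists 1; [left|].
  have [Tu|nTu] := pselect (T u).
    by exists (inS1 u); [exact/setadj1_inS1|move=> v [<-]; rewrite asboolT].
  have [h Kh [uh _]] := KP u nTu; have [t Tt uE] := greenR_factor _ _ _ uh.
  by exists t => // v [<-]; rewrite asboolF //; exists h.
pose Y := X `|` Z.
have XY : X `<=` Y by left.
have XY1 := setadj1_subset _ _ XY.
have ZY1 : setadj1 Z `<=` setadj1 Y by apply: setadj1_subset => x; right.
exists Y; split=> //; [by rewrite finite_setU|by move=> x [/XT|/ZT]|].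
move=> n w h y Xw Kh yE Ty.
(* Either the representative was absorbed, or it is still there, and then the
   product is outside [T] because its R^T-class contains [k]. *)
suff: set_pow (setadj1 Y) n (inS1 y) \/
    exists k v, [/\ K k, set_pow (setadj1 Y) n v,
      inS1 y = inS1 k * v & greenR T y k].
  case=> // -[k [v [Kk _ _ yk]]]; case: (KT k Kk).
  by apply: greenR_closed TM _ Ty; rewrite /greenR yk.
elim: n w y Xw yE {Ty} => [_ y -> [->]|n IHn _ y [x Xx [w Xw <-]]].
  by right; exists h, 1; split=> //; rewrite mulg1.
case wh: (w * inS1 h) => [u|]; last by case: w wh {Xw}.
rewrite -mulgA wh => yE.
have [Yu|[k [v [Kk Yv uE uk]]]] := IHn w u Xw (esym wh).
  left; rewrite yE; exists x; first exact: XY1.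
  by exists (inS1 u).
case xk: (x * inS1 k) => [s|]; last by case: x xk {Xx yE}.
have yE' : inS1 y = inS1 s * v.
  by rewrite yE -/(inS1 u) uE mulgA xk.
have ys : greenR T y s.
  case: x xk yE {Xx} => [x|] [<-] [->] //; exact: greenR_mull.
have [|z Zz Qz] := ZP (x * inS1 k); first by exists x => //; exists k.
have := Qz s xk; case: asboolP => [Ts zE|nTs [l [Kl sE sl]]].
  left; rewrite yE' -zE; exists z; first exact: ZY1.
  by exists v.
right; exists l, (z * v); split=> //; last by rewrite /greenR ys.
  by exists z; [exact: ZY1|exists v].
by rewrite yE' sE mulgA.
Qed.

End Green.

(** * Growth *)

Lemma growth_le_trans (a b c : nat -> nat) :
  growth_le a b -> growth_le b c -> growth_le a c.
Proof.
move=> [k1 [k2 [k1p k2p ab]]] [l1 [l2 [l1p l2p bc]]].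
exists (k1 * l1)%N, (l2 * k2)%N; split; rewrite ?muln_gt0 ?k1p ?l2p //.
move=> t; apply: leq_trans (ab t) _.
by rewrite -!mulnA leq_mul2l bc orbT.
Qed.

Lemma growth_equiv_type (a b : nat -> nat) :
  growth_equiv a b -> growth_type a = growth_type b.
Proof.
move=> [ab ba]; apply/seteqP; split=> c [gc [ac ca]]; split=> //;
  by split; apply: growth_le_trans; eassumption.
Qed.

Section Growth.
Context {S : semigroupType}.
Implicit Types (X A B T K : set S).

(** If [A] lies in the ball of radius [c] over [B], then radius [t] over [A] lies
    in radius [c * t] over [B]. *)
Lemma growth_le_subset A B : finite_set A -> finite_set B ->
  A `<=` smallest (@set_mulg_closed S) B -> growth_le (growth A) (growth B).
Proof.
move=> finA finB AB; have [c c_gt0 cP] := finite_subset_ball _ _ finA AB.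
exists 1%N, c; split=> // t; rewrite mul1n.
apply: fset_set_subset_card; last exact: finite_ball.
move=> y /ball_rightE Ay; apply/ball_rightE.
exact: (set_pow_pow _ _ _ _ cP).
Qed.

Lemma card_inS1 (X : set S) : finite_set X ->
  #|` fset_set (@inS1 S @` X)| = #|` fset_set X|.
Proof.
move=> finX; rewrite fset_set_image // card_imfset //.
Qed.

(** The factor [2] in the constant [2 * #|K^1|] pays for the identity, which
    [set_pow (setadj1 X) t] contains and a ball of [S] does not; this is where
    [X] has to be nonempty. *)
Lemma growth_le_factor A X K : finite_set A -> finite_set X -> finite_set K ->
    X !=set0 ->
    (forall n, set_pow (setadj1 A) n `<=`
      [set w * h | w in set_pow (setadj1 X) n & h in setadj1 K]) ->
  growth_le (growth A) (growth X).
Proof.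
move=> finA finX finK [x0 Xx0] AXK.
have finK1 := finite_setadj1 _ finK.
have finX1 n := finite_set_pow _ n (finite_setadj1 _ finX).
pose k := #|` fset_set (setadj1 K)|.
have k_gt0 : (0 < k)%N.
  rewrite cardfs_gt0; apply/fset0Pn; exists 1.
  by rewrite in_fset_set // inE; left.
exists (2 * k)%N, 1%N; split=> //; first by rewrite muln_gt0.
(* Radius [0] is separate: both balls are empty, as they omit the identity. *)
case=> [|t]; rewrite mul1n.
  rewrite [leqLHS](_ : _ = 0%N) //.
  have -> : growth A 0 = #|` fset_set (set0 : set S)|.
    by congr #|` fset_set _|; rewrite ball_right_setE -subset0 => y.
  by rewrite fset_set0.
have X_gt0 : (0 < growth X t.+1)%N.
  rewrite cardfs_gt0; apply/fset0Pn; exists x0.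
  rewrite in_fset_set ?inE; last exact: finite_ball.
  apply/ball_rightE/(set_pow_leq _ 1%N) => //; first by left.
  exact/set_pow1/setadj1_inS1.
have le_X : (#|` fset_set (set_pow (setadj1 X) t.+1)| <= 2 * growth X t.+1)%N.
  have finB := finite_ball _ t.+1 finX.
  apply: (@leq_trans #|` fset_set (1 |` (@inS1 S @` ball_right X 1 t.+1))|).
    apply: fset_set_subset_card.
      by move=> [y|] Xy; [right; exists y => //; exact/ball_rightE|left].
    by rewrite finite_setU; split=> //; exact: finite_image.
  rewrite fset_setU1; last exact: finite_image.
  rewrite cardfsU1 card_inS1 // mul2n -addnn leq_add2r.
  exact: leq_trans (leq_b1 _) X_gt0.
rewrite /growth -card_inS1; last exact: finite_ball.
apply: (@leq_trans (#|` fset_set (set_pow (setadj1 X) t.+1)| * k)%N).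
  apply: leq_trans (fset_set_image2_card _ (finX1 _) finK1).
  apply: fset_set_subset_card; last exact: finite_image2.
  by move=> _ [y /ball_rightE Ay <-]; apply: AXK.
by rewrite mulnAC leq_mul2r le_X orbT.
Qed.

End Growth.

Theorem corollary9p2 (S : semigroupType) (T : set S)
    (subT : subsemigroup T) (indexT : finite_green_index T) :
  (finitely_generated [set: S] <-> finitely_generated T) /\
  (finitely_generated [set: S] -> finitely_generated T ->
   same_type_of_growth [set: S] T).
Proof.
have [[t0 Tt0] TM] := subT.
have [K [finK KT KP]] := outer_transversal _ TM indexT.
split; first split.
- move=> [A [finA genA]].
  have [X [finX XT AXK]] := push_representative_right _ _ finK KP _ finA.
  have [Y [finY YT XY XKY]] :=
    push_representative_left _ _ TM finK KT KP _ finX XT.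
  exists Y; split=> //; apply/seteqP; split; first exact: smallest_sub.
  move=> y Ty; apply/smallest_mulg_closedE.
  have /smallest_mulg_closedE[n Ay] : smallest (@set_mulg_closed S) A y.
    by rewrite genA.
  have [w Xw [_ [->|[h Kh <-]] ywh]] := AXK n _ Ay; exists n.
    move: ywh; rewrite mulg1 => <-.
    by apply: set_pow_subset Xw; exact: setadj1_subset.
  exact: (XKY n w h y).
- move=> [B [finB genB]]; exists (B `|` K); split; first by rewrite finite_setU.
  apply/seteqP; split=> // y _ X [XM BKX].
  have TX : T `<=` X.
    by rewrite -genB; apply: smallest_sub => // x Bx; apply: BKX; left.
  have KX : K `<=` X by move=> x Kx; apply: BKX; right.
  have [t [h [Tt Kh yE]]] := outer_left_factor _ _ KP (inS1 y).
  apply/setadj1_inS1; rewrite yE.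
  apply: setadj1M => //; first exact: setadj1_subset TX _ Tt.
  exact: setadj1_subset KX _ Kh.
move=> _ _ A B [finA genA] [finB genB]; apply: growth_equiv_type; split.
  have [X [finX XT AXK]] := push_representative_right _ _ finK KP _ finA.
  (* [X] may be empty; adding an element of [T] makes it nonempty. *)
  have XtT : X `|` [set t0] `<=` T by move=> x [/XT|->].
  apply: (growth_le_trans _ (growth (X `|` [set t0]))).
    apply: (growth_le_factor _ _ K) => //.
    - by rewrite finite_setU.
    - by exists t0; right.
    move=> n w /AXK[x Xx [h Kh <-]]; exists x; last by exists h.
    by apply: set_pow_subset Xx; apply: setadj1_subset => y; left.
  by apply: growth_le_subset => //; rewrite ?genB // finite_setU.
by apply: growth_le_subset => //; rewrite genA.
Qed.
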